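(* Let $H=H_{b,c,m}$ be subcritical and let $s\in\mathcal{F}$ be a superharmonic function on $X$ which has a subharmonic minorant. Then there exists a unique decomposition \[ s=s_p+s_h \] such that $s_p$ is a non-negative potential with charge $Hs\in\mathcal{G}$ and $s_h=\operatorname{ghm}_s$; in particular, $s$ has a greatest harmonic minorant. Moreover, if $s\ge 0$ then $s_h\ge 0$, and $s$ is the potential of a non-negative charge if and only if $s_h=0$.
   Context: Setting: $X$ is an infinite set with the discrete topology; $b\colon X\times X\to[0,\infty)$ is symmetric, vanishes on the diagonal, and satisfies $\deg(x)=\sum_{y\in X}b(x,y)<\infty$ for all $x\in X$ (a graph over $X$). $X$ is connected with respect to $b$: any $x,y\in X$ are joined by a path $x=x_0,\dots,x_n=y$ in $X$ with $b(x_{i-1},x_i)>0$ for all $i$. Further, $c\colon X\to\mathbb{R}$ is an arbitrary function and $m\colon X\to(0,\infty)$. $\mathcal{C}(X)$ is the space of real-valued functions on $X$, and $\mathcal{C}_c(X)$ the subspace of finitely supported functions. For $K\subseteq X$, $\mathcal{C}(K)$ is viewed as a subspace of $\mathcal{C}(X)$ via extension by zero. Let $\mathcal{F}=\{f\in\mathcal{C}(X) : \sum_{y\in X}b(x,y)|f(y)|<\infty \text{ for all } x\in X\}$. The Schrödinger operator $H=H_{b,c,m}$ acts on $\mathcal{F}$ by \[ Hf(x)=\frac1{m(x)}\sum_{y\in X}b(x,y)\bigl(f(x)-f(y)\bigr)+\frac{c(x)}{m(x)}f(x),\qquad x\in X. \] A function $u\in\mathcal{F}$ is harmonic (superharmonic,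 subharmonic) if $Hu=0$ ($Hu\ge0$, $Hu\le0$) on $X$. $H$ is non-negative on $\mathcal{C}_c(X)$ if $\sum_{x\in X}(H\varphi)(x)\varphi(x)m(x)\ge0$ for all $\varphi\in\mathcal{C}_c(X)$. Green's function: suppose $H$ is non-negative on $\mathcal{C}_c(X)$. For finite $K\subseteq X$, the restriction $H^K$ of $H$ to $\mathcal{C}(K)$ (i.e. $H^K\varphi=(H\varphi)|_K$) is invertible. For an increasing exhaustion $(K_n)$ of $X$ by finite sets, let $G(x,y)=\lim_{n\to\infty}(H^{K_n})^{-1}1_y(x)\in[0,\infty]$, where $1_y$ is the characteristic function of $\{y\}$; this is independent of the exhaustion. $H$ is called subcritical if it is non-negative on $\mathcal{C}_c(X)$ and $G(x,y)<\infty$ for some (equivalently, all) $x,y\in X$. Let $\mathcal{G}=\{f\in\mathcal{C}(X) : \sum_{y\in X}G(x,y)|f(y)|<\infty\text{ for all }x\in X\}$ and, for $f\in\mathcal{G}$, $Gf(x)=\sum_{y\in X}G(x,y)f(y)$. For subcritical $H$, a function $p\in\mathcal{C}(X)$ is a potential if $p=Gf$ for some $f\in\mathcal{G}$; then $f$ is called a charge of $p$ and $p$ the potential of $f$. A function $g$ is a minorant of $f$ if $g\le f$ on $X$. The greatest harmonic minorant of $f\in\mathcal{C}(X)$, denoted $\operatorname{ghm}_f$, is (if it exists) the harmonic minorant $h$ of $f$ such that $g\le h$ for every harmonic minorant $g$ of $f$. *)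

(* Defs.v *)
From HB Require Import structures.
From mathcomp Require Import all_boot all_order all_algebra finmap.
From mathcomp Require Import all_classical all_reals all_analysis.

Set Implicit Arguments.
Unset Strict Implicit.
Unset Printing Implicit Defensive.

Import Order.TTheory GRing.Theory Num.Theory.
Import numFieldNormedType.Exports.

Local Open Scope classical_set_scope.
Local Open Scope ring_scope.

Section Schrodinger.
Context {R : realType} {X : choiceType}.
Implicit Types (b : X -> X -> R) (c m f g h u p s : X -> R).

(* The sum over X of an absolutely summable real family; for other families
   the value carries no meaning. *)
Definition rsum f : R :=
  fine (\esum_(y in [set: X]) ((EFin \o f)^\+ y) -
        \esum_(y in [set: X]) ((EFin \o f)^\- y))%E.

Definition is_graph b : Prop :=
  [/\ forall x y, 0 <= b x y,
      forall x y, b x y = b y x,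
      forall x, b x x = 0 &
      forall x, (\esum_(y in [set: X]) (b x y)%:E < +oo)%E].

Definition connected_graph b : Prop :=
  forall x y, exists2 q : seq X, path (fun z w => 0 < b z w) x q & last x q = y.

Definition formal_domain b : set (X -> R) :=
  [set f | forall x, (\esum_(y in [set: X]) (b x y * `|f y|)%:E < +oo)%E].

Definition schrodinger b c m f : X -> R := fun x =>
  (m x)^-1 * rsum (fun y => b x y * (f x - f y)) + c x / m x * f x.

Definition harmonic b c m u : Prop :=
  formal_domain b u /\ forall x, schrodinger b c m u x = 0.

Definition superharmonic b c m u : Prop :=
  formal_domain b u /\ forall x, 0 <= schrodinger b c m u x.

Definition subharmonic b c m u : Prop :=
  formal_domain b u /\ forall x, schrodinger b c m u x <= 0.

(* C(K), extended by zero outside K *)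
Definition supported_in (K : set X) : set (X -> R) :=
  [set f | forall x, ~ K x -> f x = 0].

(* The support of the summand is finite because that of f is, so the
   finitely supported sum below is the full sum over X. *)
Definition nonneg_on_Cc b c m : Prop :=
  forall f, finite_set [set x | f x != 0] ->
    0 <= \sum_(x \in [set: X]) schrodinger b c m f x * f x * m x.

Definition dirichlet_restriction b c m (K : set X) f : X -> R :=
  patch (cst 0) K (schrodinger b c m f).

(* The inverse of H^K as a map of C(K); it is only meaningful on C(K), and
   when H^K is bijective there. *)
Definition dirichlet_inverse b c m (K : set X) : (X -> R) -> (X -> R) :=
  'pinv_(fun=> cst 0) (supported_in K) (dirichlet_restriction b c m K).

Definition exhaustion (K : nat -> set X) : Prop :=
  [/\ forall n, finite_set (K n),
      forall n, K n `<=` K n.+1 &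
      \bigcup_n K n = [set: X]].

Definition green b c m (K : nat -> set X) (x y : X) : \bar R :=
  limn (fun n => (dirichlet_inverse b c m (K n) \1_[set y] x)%:E).

Definition subcritical b c m (K : nat -> set X) : Prop :=
  nonneg_on_Cc b c m /\ exists x y, (green b c m K x y < +oo)%E.

Definition green_domain b c m (K : nat -> set X) : set (X -> R) :=
  [set f | forall x,
    (\esum_(y in [set: X]) (green b c m K x y * `|f y|%:E) < +oo)%E].

(* For subcritical H the Green function is finite everywhere, so fine loses
   nothing. *)
Definition green_op b c m (K : nat -> set X) f : X -> R := fun x =>
  rsum (fun y => fine (green b c m K x y) * f y).

Definition potential_of b c m (K : nat -> set X) p f : Prop :=
  green_domain b c m K f /\ p = green_op b c m K f.

Definition minorant g f : Prop := forall x, g x <= f x.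

Definition is_ghm b c m f h : Prop :=
  [/\ harmonic b c m h, minorant h f &
      forall g, harmonic b c m g -> minorant g f -> minorant g h].

Definition riesz_decomposition b c m (K : nat -> set X) s sp sh : Prop :=
  [/\ forall x, s x = sp x + sh x,
      forall x, 0 <= sp x,
      potential_of b c m K sp (schrodinger b c m s) &
      is_ghm b c m s sh].

(* A connected graph is countable, so exhaustions by finite sets exist and
   quantifying over them is never vacuous. *)
Lemma countable_neighbors b (x : X) : is_graph b ->
  countable [set y | 0 < b x y].
Proof.
move=> [b0 _ _ bfin].
have -> : [set y | 0 < b x y] =
    \bigcup_(n : nat) [set y | n.+1%:R^-1 < b x y].
  apply/seteqP; split=> [y /= by0|y [n _] /= ]; last first.
    by apply: le_lt_trans; rewrite invr_ge0.
  have [n _ /(_ n (leqnn n)) /= h] := near_infty_natSinv_lt (PosNum by0).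
  by exists n.
apply: bigcup_countable => // n _; apply: finite_set_countable.
apply: contrapT => inf.
have bE : \esum_(y in [set: X]) (b x y)%:E \is a fin_num.
  by rewrite ge0_fin_numE ?bfin// esum_ge0// => y _; rewrite lee_fin.
set B := fine (\esum_(y in [set: X]) (b x y)%:E).
have [F FA cF] := infinite_set_fset (Num.bound (n.+1%:R * B)) inf.
have B0 : 0 <= B by rewrite fine_ge0// esum_ge0// => y _; rewrite lee_fin.
suff : (#|` F|%:R <= n.+1%:R * B).
  apply/negP; rewrite -ltNge.
  apply: (lt_le_trans (archi_boundP _)); first by rewrite mulr_ge0.
  by rewrite ler_nat.
rewrite -ler_pdivrMl// -lee_fin fineK//.
apply: (@le_trans _ _ (\sum_(y \in [set` F]) (b x y)%:E)%E); last first.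
  by apply: esum_ge; exists [set` F] => //; split.
rewrite fsbig_finite//= set_fsetK sumEFin lee_fin.
rewrite -sum1_size natr_sum mulr_sumr big_seq [leRHS]big_seq.
by apply: ler_sum => y yF; rewrite mulr1; apply/ltW/FA.
Qed.

Lemma exhaustion_exists b : is_graph b -> connected_graph b ->
  exists K : nat -> set X, exhaustion K.
Proof.
move=> bg bc.
have [X0|/set0P [x0 _] ] := eqVneq [set: X] set0.
  exists (fun=> set0); split=> [n|n y|]; [exact: finite_set0|by []|].
  by rewrite X0; apply/seteqP; split=> y [].
pose S := fix S n := if n is n'.+1 then
  \bigcup_(z in S n') [set y | 0 < b z y] else [set x0].
have Sc n : countable (S n).
  elim: n => [|n ih] /=; first exact: finite_set_countable.
  by apply: bigcup_countable => // z _; exact: countable_neighbors.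
have ST : \bigcup_n S n = [set: X].
  apply/seteqP; split=> // y _; have [q pq <-] := bc x0 y.
  exists (size q) => //; elim/last_ind: q pq => [|q z ih] //=.
  rewrite rcons_path last_rcons size_rcons => /andP[pq bz].
  by exists (last x0 q) => //; exact: ih.
have : countable [set: X] by rewrite -ST; exact: bigcup_countable.
move=> /pfcard_geP[X0|[f] ]; first by move: (I : [set: X] x0); rewrite X0.
exists (fun n => f @` `I_n); split.
- by move=> n; apply: finite_image.
- by move=> n; apply: image_subset => k /= /ltnW.
- apply/seteqP; split=> // y _; have [k _ <-] := @surj _ _ _ _ f y I.
  by exists k.+1 => //; exists k => /=.
Qed.
End Schrodinger.

(* Main.v *)
(* Exhaust X by the finite sets K_n and let s_n solve H s_n = H s on K_n with
   zero boundary values, i.e. s_n = G_n (H s) for the Dirichlet Green function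
   G_n of K_n.  The s_n increase, and by the minimum principle on K_n,
   s_n <= s - g for every subharmonic minorant g of s; hence H s is a charge and
   s_p = G (H s) = lim s_n satisfies s_p <= s - g.  Passing to the limit in
   H s_n = H s gives H s_p = H s, so s - s_p is a harmonic minorant of s, and the
   bound s_p <= s - g says exactly that it is the greatest one.  The minimum
   principle, and with it the solvability of the Dirichlet problem, comes from
   the definiteness of the quadratic form on finitely supported functions. *)

Require Import Defs.
From mathcomp Require Import all_boot all_order all_algebra.
From mathcomp Require Import all_classical all_reals all_analysis.
From mathcomp Require Import ring lra.
Import Order.TTheory GRing.Theory Num.Theory.
Import numFieldNormedType.Exports.
Local Open Scope classical_set_scope.
Local Open Scope ring_scope.

(** * Absolutely convergent real sums over a discrete set *)

Section AbsolutelyConvergentSums.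
Context {R : realType} {X : choiceType}.
Implicit Types (f g h : X -> R) (r : seq X).

Definition summable_real f : Prop := summable [set: X] (EFin \o f).

Lemma max0_ge0 (t : R) : 0 <= Num.max t 0.
Proof. by rewrite le_max lexx orbT. Qed.

Lemma max0_subN (t : R) : Num.max t 0 - Num.max (- t) 0 = t.
Proof. by case: (leP 0 t) => t0; [rewrite max_r|rewrite max_l]; lra. Qed.

Lemma esum_le_real f (C : R) :
  (forall r, uniq r -> \sum_(x <- r) f x <= C) ->
  (\esum_(x in [set: X]) (f x)%:E <= C%:E)%E.
Proof.
move=> fC; apply: ge_ereal_sup => _ [F [finF _] <-].
by rewrite fsbig_finite//= sumEFin lee_fin fC// finmap.fset_uniq.
Qed.

Lemma esum_ge_real f r : uniq r ->
  ((\sum_(x <- r) f x)%:E <= \esum_(x in [set: X]) (f x)%:E)%E.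
Proof.
move=> ur; apply: esum_ge; exists [set` r]; first by split.
by rewrite -fsbig_seq// sumEFin.
Qed.

Lemma summable_realP f :
  summable_real f <-> (\esum_(x in [set: X]) (`|f x|)%:E < +oo)%E.
Proof. by []. Qed.

Lemma summable_real_ub f (C : R) :
  (forall r, uniq r -> \sum_(x <- r) `|f x| <= C) -> summable_real f.
Proof.
by move=> fC; apply/summable_realP/(le_lt_trans (esum_le_real _ _ fC))/ltry.
Qed.

Lemma summable_real_le f g : (forall x, `|f x| <= `|g x|) ->
  summable_real g -> summable_real f.
Proof.
by move=> fg; apply: le_lt_trans; apply: le_esum => x _; rewrite lee_fin.
Qed.

Lemma summable_realD f g : summable_real f -> summable_real g ->
  summable_real (fun x => f x + g x).
Proof. by move=> sf sg; exact: (summableD sf sg). Qed.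

Lemma summable_realN f : summable_real f -> summable_real (fun x => - f x).
Proof. by apply: summable_real_le => x; rewrite normrN. Qed.

Lemma summable_real_pos f : summable_real f ->
  summable_real (fun x => Num.max (f x) 0).
Proof.
apply: summable_real_le => x; case: (leP 0 (f x)) => // _.
by rewrite normr0.
Qed.

Lemma esum_fin_num f : (forall x, 0 <= f x) -> summable_real f ->
  (\esum_(x in [set: X]) (f x)%:E \is a fin_num)%E.
Proof.
move=> f0 sf; rewrite ge0_fin_numE; last first.
  by apply: esum_ge0 => x _; rewrite lee_fin.
apply: le_lt_trans sf; apply: le_esum => x _.
by rewrite lee_fin ler_norm.
Qed.

(** Any splitting into non-negative summable families computes [rsum], not only the one into
    positive and negative parts. Additivity rests on this, since the positive part of a sum is not
    the sum of the positive parts. *)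
Lemma rsumB_ge0 f g : (forall x, 0 <= f x) -> (forall x, 0 <= g x) ->
  summable_real f -> summable_real g ->
  rsum (fun x => f x - g x) = fine (\esum_(x in [set: X]) (f x)%:E) -
                              fine (\esum_(x in [set: X]) (g x)%:E).
Proof.
move=> f0 g0 sf sg; rewrite /rsum.
have e := esumB sf sg.
have -> : EFin \o (fun x => f x - g x) = ((EFin \o f) \- (EFin \o g))%E by [].
rewrite e; [|by move=> x _; rewrite lee_fin..].
by rewrite fineB ?esum_fin_num.
Qed.

Lemma rsum_ge0E f : (forall x, 0 <= f x) -> summable_real f ->
  rsum f = fine (\esum_(x in [set: X]) (f x)%:E).
Proof.
move=> f0 sf; have s0 : summable_real (fun=> 0 : R).
  by apply: (@summable_real_ub _ 0) => r _; rewrite normr0 big1.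
have := rsumB_ge0 f (fun=> 0) f0 (fun=> lexx _) sf s0.
rewrite [X in _ - fine X]esum1// subr0 => <-; congr rsum.
by apply/funext => x; rewrite subr0.
Qed.

Lemma fine_esumD f g : (forall x, 0 <= f x) -> (forall x, 0 <= g x) ->
  summable_real f -> summable_real g ->
  fine (\esum_(x in [set: X]) (f x + g x)%:E) =
  fine (\esum_(x in [set: X]) (f x)%:E) + fine (\esum_(x in [set: X]) (g x)%:E).
Proof.
move=> f0 g0 sf sg; rewrite -fineD ?esum_fin_num// -esumD//.
  by move=> x _; rewrite lee_fin.
by move=> x _; rewrite lee_fin.
Qed.

Lemma rsum_posneg f : summable_real f ->
  rsum f = fine (\esum_(x in [set: X]) (Num.max (f x) 0)%:E) -
           fine (\esum_(x in [set: X]) (Num.max (- f x) 0)%:E).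
Proof.
move=> sf; rewrite -rsumB_ge0.
- by congr rsum; apply/funext => x; rewrite max0_subN.
- by move=> x; exact: max0_ge0.
- by move=> x; exact: max0_ge0.
- exact: summable_real_pos.
- exact/summable_real_pos/summable_realN.
Qed.

Lemma rsumD f g : summable_real f -> summable_real g ->
  rsum (fun x => f x + g x) = rsum f + rsum g.
Proof.
move=> sf sg; rewrite (rsum_posneg f)// (rsum_posneg g)//.
have sp h := summable_real_pos h.
have sn h : summable_real h -> summable_real (fun x => Num.max (- h x) 0).
  by move=> ?; exact/summable_real_pos/summable_realN.
rewrite addrACA -opprD -!fine_esumD;
  try by [|move=> x; exact: max0_ge0|exact: sp|exact: sn].
rewrite -rsumB_ge0; last first.
- by apply: summable_realD; exact: sn.
- by apply: summable_realD; exact: sp.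
- by move=> x; rewrite addr_ge0 ?max0_ge0.
- by move=> x; rewrite addr_ge0 ?max0_ge0.
congr rsum; apply/funext => x.
by rewrite -{1}(max0_subN (f x)) -{1}(max0_subN (g x)) opprD addrACA.
Qed.

Lemma rsumN f : summable_real f -> rsum (fun x => - f x) = - rsum f.
Proof.
move=> sf; apply/eqP; rewrite -addr_eq0 -rsumD//; last exact: summable_realN.
rewrite [X in rsum X](_ : _ = fun=> 0); last first.
  by apply/funext => x; rewrite addNr.
rewrite rsum_ge0E ?esum1//.
by apply: (@summable_real_ub _ 0) => r _; rewrite normr0 big1.
Qed.

Lemma rsum_ge0 f : (forall x, 0 <= f x) -> summable_real f -> 0 <= rsum f.
Proof.
move=> f0 sf; rewrite rsum_ge0E// fine_ge0// esum_ge0// => x _.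
by rewrite lee_fin.
Qed.

Lemma ler_rsum f g : (forall x, f x <= g x) -> summable_real f ->
  summable_real g -> rsum f <= rsum g.
Proof.
move=> fg sf sg.
rewrite -subr_ge0 -rsumN// -rsumD//; last exact: summable_realN.
apply: rsum_ge0 => [x|]; first by rewrite subr_ge0.
by apply: summable_realD => //; exact: summable_realN.
Qed.

(** Together with [rsum_lb], this reduces later estimates of infinite sums to estimates of finite
    partial sums. *)
Lemma rsum_ub f (C : R) : (forall x, 0 <= f x) ->
  (forall r, uniq r -> \sum_(x <- r) f x <= C) ->
  summable_real f /\ rsum f <= C.
Proof.
move=> f0 fC; have sf : summable_real f.
  apply: (@summable_real_ub _ C) => r /fC; apply: le_trans.
  by apply: ler_sum => x _; rewrite ger0_norm.
split=> //; rewrite rsum_ge0E// -lee_fin fineK ?esum_fin_num//.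
exact: esum_le_real.
Qed.

Lemma rsum_lb f r : (forall x, 0 <= f x) -> summable_real f ->
  uniq r -> \sum_(x <- r) f x <= rsum f.
Proof.
move=> f0 sf ur; rewrite rsum_ge0E// -lee_fin fineK ?esum_fin_num//.
exact: esum_ge_real.
Qed.

Lemma ler_sum_subset f r r' : uniq r -> uniq r' -> {subset r' <= r} ->
  (forall x, x \in r -> 0 <= f x) -> \sum_(x <- r') f x <= \sum_(x <- r) f x.
Proof.
move=> ur ur' sub f0.
rewrite [leRHS](bigID (mem r')) /= -[X in _ <= X + _]big_filter.
rewrite (perm_big [seq x <- r | x \in r']).
  by rewrite lerDl big_seq_cond sumr_ge0// => x /andP[/f0].
apply: uniq_perm; rewrite ?filter_uniq// => x; rewrite mem_filter.
by case: (boolP (x \in r')) => //= /sub.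
Qed.

Lemma ler_sum_supp f r r' : uniq r -> uniq r' -> (forall x, 0 <= f x) ->
  (forall x, x \notin r -> f x = 0) -> \sum_(x <- r') f x <= \sum_(x <- r) f x.
Proof.
move=> ur ur' f0 fr.
rewrite (bigID (mem r)) /= [X in _ + X]big1 => [|x /fr//]; rewrite addr0.
rewrite -big_filter; apply: ler_sum_subset => //; first exact: filter_uniq.
by move=> x; rewrite mem_filter => /andP[].
Qed.

(** For a non-negative family the sum over [r] is the largest partial sum; the general case follows
    by splitting into positive and negative parts. *)
Lemma rsum_finite f r : uniq r -> (forall x, x \notin r -> f x = 0) ->
  summable_real f /\ rsum f = \sum_(x <- r) f x.
Proof.
move=> ur.
have ge0 g : (forall x, 0 <= g x) -> (forall x, x \notin r -> g x = 0) ->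
    summable_real g /\ rsum g = \sum_(x <- r) g x.
  move=> g0 gr; have [sg le] := @rsum_ub g (\sum_(x <- r) g x) g0
    (fun r' ur' => ler_sum_supp g r r' ur ur' g0 gr).
  by split=> //; apply/eqP; rewrite eq_le le rsum_lb.
move=> fr.
have [||sp ep] := ge0 (fun x => Num.max (f x) 0) => [x|x /fr ->|].
- exact: max0_ge0.
- by rewrite maxxx.
have [||sn en] := ge0 (fun x => Num.max (- f x) 0) => [x|x /fr ->|].
- exact: max0_ge0.
- by rewrite oppr0 maxxx.
have fE : f = fun x => Num.max (f x) 0 + - Num.max (- f x) 0.
  by apply/funext => x; rewrite max0_subN.
have sn' := summable_realN _ sn.
split; first by rewrite fE; exact: summable_realD.
rewrite {1}fE rsumD// rsumN// ep en -sumrB.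
by apply: eq_bigr => x _; rewrite {3}fE.
Qed.

Lemma summable_realZ f (a : R) : summable_real f ->
  summable_real (fun x => a * f x).
Proof.
move=> sf; have sf' : summable_real (fun x => `|f x|).
  by apply: summable_real_le sf => x; rewrite normr_id.
apply: (@summable_real_ub _ (`|a| * rsum (fun x => `|f x|))) => r ur.
under eq_bigr do rewrite normrM.
by rewrite -mulr_sumr ler_wpM2l// rsum_lb.
Qed.

Lemma rsumZ f (a : R) : summable_real f ->
  rsum (fun x => a * f x) = a * rsum f.
Proof.
have le_pos (t : R) g : 0 <= t -> (forall x, 0 <= g x) -> summable_real g ->
    rsum (fun x => t * g x) <= t * rsum g.
  move=> t0 g0 sg.
  apply: (rsum_ub _ _ _ _).2 => [x|r ur]; first by rewrite mulr_ge0.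
  by rewrite -mulr_sumr ler_wpM2l// rsum_lb.
have pos (t : R) g : 0 <= t -> (forall x, 0 <= g x) -> summable_real g ->
    rsum (fun x => t * g x) = t * rsum g.
  move=> t0 g0 sg; apply/eqP; rewrite eq_le le_pos//=.
  have [->|tn0] := eqVneq t 0.
    rewrite mul0r rsum_ge0// => [x|]; first by rewrite mul0r.
    exact: summable_realZ.
  (* Partial sums give one inequality only; the reverse one is the same inequality for the factor
     [t^-1] and the family [t * g]. *)
  rewrite -ler_pdivlMl ?lt0r ?tn0//.
  apply: le_trans (le_pos _ _ _ _ _); last 3 first.
  - by rewrite invr_ge0.
  - by move=> x; rewrite mulr_ge0.
  - exact: summable_realZ.
  by under [in leRHS]eq_fun do rewrite mulKf//.
have posf (t : R) g : 0 <= t -> summable_real g ->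
    rsum (fun x => t * g x) = t * rsum g.
  move=> t0 sg.
  have sp := summable_real_pos _ sg.
  have sn := summable_real_pos _ (summable_realN _ sg).
  have eg : rsum g = rsum (fun x => Num.max (g x) 0) -
                     rsum (fun x => Num.max (- g x) 0).
    rewrite -rsumN// -rsumD//; last exact: summable_realN.
    by congr rsum; apply/funext => x; rewrite max0_subN.
  rewrite eg mulrBr -!pos//; try by move=> x; exact: max0_ge0.
  have sZ h : summable_real h -> summable_real (fun x => t * h x).
    exact: summable_realZ.
  have [sZp sZn] := (sZ _ sp, sZ _ sn).
  rewrite -rsumN// -rsumD//; last exact: summable_realN.
  by congr rsum; apply/funext => x; rewrite -{1}(max0_subN (g x)) mulrBr.
move=> sf; have [a0|a0] := leP 0 a; first exact: posf.
rewrite -[in RHS](opprK a) mulNr -posf ?oppr_ge0 1?ltW// -rsumN; last first.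
  exact: summable_realZ.
by congr rsum; apply/funext => x; rewrite mulNr opprK.
Qed.

End AbsolutelyConvergentSums.

(** * Finite linear systems indexed by a list *)

Lemma finite_system_solvable (F : fieldType) (X : choiceType) (r : seq X)
    (a : X -> X -> F) : uniq r ->
  (forall v, (forall x, x \notin r -> v x = 0) ->
     (forall x, x \in r -> \sum_(y <- r) a x y * v y = 0) ->
     forall x, v x = 0) ->
  forall f, exists2 v, forall x, x \notin r -> v x = 0 &
    forall x, x \in r -> \sum_(y <- r) a x y * v y = f x.
Proof.
move=> ur inj f.
pose n := size r; pose e (i : 'I_n) := tnth (in_tuple r) i.
pose ext (w : 'rV[F]_n) x := oapp (fun i => w 0 i) 0 (insub (index x r)).
have ext0 w x : x \notin r -> ext w x = 0.
  by move=> xr; rewrite /ext insubN// index_mem.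
have extE w i : ext w (e i) = w 0 i.
  rewrite /ext /e (tnth_nth (e i)) /= index_uniq//.
  rewrite (insubT (fun k => k < n)%N (ltn_ord i)) /=.
  by congr (w _ _); exact/val_inj.
have eP x : x \in r -> exists i, x = e i.
  by move=> /(@tnthP _ _ (in_tuple r)).
(* The indices are swapped because unknowns are row vectors multiplied from the left. A square
   system with trivial kernel has an invertible matrix. *)
pose A : 'M[F]_n := \matrix_(i, j) a (e j) (e i).
have AE w i : \sum_(y <- r) a (e i) y * ext w y = (w *m A) 0 i.
  rewrite mxE big_tnth; apply: eq_bigr => j _.
  by rewrite mxE mulrC; congr (_ * _); exact: extE.
have Au : A \in unitmx.
  rewrite -row_free_unit; apply/inj_row_free => w wA.
  apply/rowP => i; rewrite mxE -extE; apply: inj => [|x]; first exact: ext0.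
  by move=> /eP[j ->]; rewrite AE wA mxE.
exists (ext ((\row_i f (e i)) *m invmx A)) => [|x /eP[i ->]]; first exact: ext0.
by rewrite AE mulmxKV// mxE.
Qed.

(** * The weighted adjacency operator and the operator of the quadratic form *)

Section SchrodingerForm.
Context {R : realType} {X : choiceType} (b : X -> X -> R) (c m : X -> R).
Hypothesis X_infinite : infinite_set [set: X].
Hypothesis b_graph : is_graph b.
Hypothesis b_connected : connected_graph b.
Hypothesis m_gt0 : forall x, 0 < m x.
Implicit Types (f g u v : X -> R) (r : seq X).

Definition adj f x : R := rsum (fun y => b x y * f y).

(** This is [m H] on the formal domain, with [rsum (b x)] the degree of [x]. Multiplying by [m]
    makes the operator symmetric for the counting measure, and the diagonal is separated from the
    non-negative kernel [b]. *)
Definition form_op f x : R := (rsum (b x) + c x) * f x - adj f x.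

Let b_ge0 x y : 0 <= b x y. Proof. by case: b_graph. Qed.

Let b_sym x y : b x y = b y x. Proof. by case: b_graph. Qed.

Let b_diag x : b x x = 0. Proof. by case: b_graph. Qed.

Lemma formal_domainP f :
  formal_domain b f <-> forall x, summable_real (fun y => b x y * f y).
Proof.
have e x : (fun y => (b x y * `|f y|)%:E) = (fun y => (`|b x y * f y|)%:E).
  by apply/funext => y; rewrite normrM (ger0_norm (b_ge0 _ _)).
by split=> /= df x; [apply/summable_realP; rewrite -e|rewrite e]; exact: df.
Qed.

Let b_summable x : summable_real (b x).
Proof.
have [_ _ _ /(_ x)] := b_graph; apply: le_lt_trans; apply: le_esum => y _.
by rewrite lee_fin ger0_norm.
Qed.

Lemma formal_domain_finite f r : (forall x, x \notin r -> f x = 0) ->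
  formal_domain b f.
Proof.
move=> fr; apply/formal_domainP => x.
apply: (rsum_finite _ _ (undup_uniq r) _).1 => y; rewrite mem_undup.
by move=> /fr ->; rewrite mulr0.
Qed.

Lemma formal_domain_le f g : (forall x, `|f x| <= `|g x|) ->
  formal_domain b g -> formal_domain b f.
Proof.
move=> fg /formal_domainP dg; apply/formal_domainP => x.
apply: summable_real_le (dg x) => y.
by rewrite !normrM ler_wpM2l.
Qed.

Lemma formal_domainD f g : formal_domain b f -> formal_domain b g ->
  formal_domain b (fun x => f x + g x).
Proof.
move=> /formal_domainP df /formal_domainP dg; apply/formal_domainP => x.
under eq_fun do rewrite mulrDr.
exact: summable_realD.
Qed.

Lemma formal_domainN f : formal_domain b f -> formal_domain b (fun x => - f x).
Proof. by apply: formal_domain_le => x; rewrite normrN. Qed.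

Lemma adjD f g x : formal_domain b f -> formal_domain b g ->
  adj (fun y => f y + g y) x = adj f x + adj g x.
Proof.
move=> /formal_domainP df /formal_domainP dg; rewrite /adj -rsumD//.
by under eq_fun do rewrite mulrDr.
Qed.

Lemma adjN f x : formal_domain b f -> adj (fun y => - f y) x = - adj f x.
Proof.
move=> /formal_domainP df; rewrite /adj -rsumN//.
by under eq_fun do rewrite mulrN.
Qed.

Lemma adjZ a f x : formal_domain b f -> adj (fun y => a * f y) x = a * adj f x.
Proof.
move=> /formal_domainP df; rewrite /adj -rsumZ//.
by under eq_fun do rewrite mulrCA.
Qed.

Lemma ler_adj f g x : (forall y, f y <= g y) -> formal_domain b f ->
  formal_domain b g -> adj f x <= adj g x.
Proof.
move=> fg /formal_domainP df /formal_domainP dg; apply: ler_rsum => // y.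
by rewrite ler_wpM2l.
Qed.

Lemma adj_finite f r x : uniq r -> (forall y, y \notin r -> f y = 0) ->
  adj f x = \sum_(y <- r) b x y * f y.
Proof.
move=> ur fr; apply: (rsum_finite _ _ ur _).2 => y /fr ->.
by rewrite mulr0.
Qed.

Lemma form_opD f g x : formal_domain b f -> formal_domain b g ->
  form_op (fun y => f y + g y) x = form_op f x + form_op g x.
Proof. by move=> df dg; rewrite /form_op adjD//; ring. Qed.

Lemma form_opN f x : formal_domain b f ->
  form_op (fun y => - f y) x = - form_op f x.
Proof. by move=> df; rewrite /form_op adjN//; ring. Qed.

Lemma form_opB f g x : formal_domain b f -> formal_domain b g ->
  form_op (fun y => f y - g y) x = form_op f x - form_op g x.
Proof.
by move=> df dg; rewrite form_opD ?form_opN//; exact: formal_domainN.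
Qed.

Lemma schrodingerE f x : formal_domain b f ->
  m x * schrodinger b c m f x = form_op f x.
Proof.
move=> /formal_domainP df; rewrite /schrodinger.
have -> : (fun y => b x y * (f x - f y)) =
          (fun y => f x * b x y + - (b x y * f y)).
  by apply/funext => y; rewrite mulrBr mulrC.
rewrite rsumD ?rsumN ?rsumZ//; last 2 first.
- exact: summable_realZ.
- exact: summable_realN.
rewrite /form_op /adj; have := lt0r_neq0 (m_gt0 x).
by move=> mx; field.
Qed.

(** Both sides are a diagonal sum minus a finite double sum over [r] with the symmetric kernel
    [b]. *)
Lemma form_op_symmetric f g r : uniq r -> (forall x, x \notin r -> f x = 0) ->
  (forall x, x \notin r -> g x = 0) ->
  \sum_(x <- r) form_op f x * g x = \sum_(x <- r) f x * form_op g x.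
Proof.
move=> ur fr gr; rewrite /form_op.
under eq_bigr do rewrite (adj_finite _ _ _ ur fr) mulrBl mulr_suml.
under [RHS]eq_bigr do rewrite (adj_finite _ _ _ ur gr) mulrBr mulr_sumr.
rewrite !big_split/= !sumrN; congr (_ - _).
  by apply: eq_bigr => x _; ring.
rewrite exchange_big/=; apply: eq_bigr => x _; apply: eq_bigr => y _.
by rewrite (b_sym y x); ring.
Qed.

(** * Definiteness, the minimum principle and the Dirichlet problem *)

Section Nonnegative.
Hypothesis form_ge0 : nonneg_on_Cc b c m.

Lemma form_op_ge0 f r : uniq r -> (forall x, x \notin r -> f x = 0) ->
  0 <= \sum_(x <- r) form_op f x * f x.
Proof.
move=> ur fr; have := form_ge0 f.
have sub : [set x | f x != 0] `<=` [set` r].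
  by move=> x /=; apply: contraNT => /fr ->.
move=> /(_ (sub_finite_set sub (finite_seq r))).
rewrite -(fsbig_widen [set` r])//; last first.
  by move=> x /= [_ /negP/fr ->]; rewrite mulr0 mul0r.
rewrite -fsbig_seq//; congr (_ <= _); apply: eq_bigr => x _.
by rewrite -schrodingerE; [ring|exact: formal_domain_finite fr].
Qed.

(* A non-negative form vanishing at [f] has [f] in its radical, so [f] is
   harmonic; a finitely supported function [f >= 0] has a zero, from which
   harmonicity propagates zeros along edges. *)
Lemma form_op_definite f r : uniq r -> (forall x, x \notin r -> f x = 0) ->
  (forall x, 0 <= f x) -> \sum_(x <- r) form_op f x * f x <= 0 ->
  forall x, f x = 0.
Proof.
move=> ur fr f0 Qf.
have df := formal_domain_finite _ _ fr.
have Lf z : form_op f z = 0.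
  (* The form is tested on [f + t e] with [e] the indicator of [z]; [r] is enlarged because [z] may
     lie outside it. *)
  pose r' := undup (z :: r); have ur' : uniq r' := undup_uniq _.
  pose e x : R := (x == z)%:R.
  have er x : x \notin r' -> e x = 0.
    by rewrite mem_undup inE negb_or => /andP[/negbTE xz _]; rewrite /e xz.
  have fr' x : x \notin r' -> f x = 0.
    by rewrite mem_undup inE negb_or => /andP[_ /fr].
  have sum_e g : \sum_(x <- r') g x * e x = g z.
    rewrite (bigD1_seq z)//= ?mem_undup ?mem_head// /e eqxx mulr1 big1 ?addr0//.
    by move=> x /negbTE ->; rewrite mulr0.
  have de := formal_domain_finite _ _ er.
  have dZ t : formal_domain b (fun x => t * e x).
    by apply: (formal_domain_finite _ r') => x /er ->; rewrite mulr0.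
  have Qf' : \sum_(x <- r') form_op f x * f x <= 0.
    apply: le_trans Qf; rewrite (bigID (mem r)) /= [X in _ + X]big1 ?addr0.
      rewrite -big_filter (perm_big r)//; apply: uniq_perm => // [|x].
        exact: filter_uniq.
      rewrite mem_filter mem_undup inE; case: (boolP (x \in r)) => //= _.
      by rewrite orbT.
    by move=> x /fr ->; rewrite mulr0.
  have ez : form_op e z = rsum (b z) + c z.
    rewrite /form_op /e eqxx mulr1 (adj_finite _ _ _ ur' er).
    rewrite (sum_e (b z)) b_diag subr0//.
  have Q t : 0 <= 2 * t * form_op f z + t ^+ 2 * (rsum (b z) + c z).
    have te0 x : x \notin r' -> f x + t * e x = 0.
      by move=> xr; rewrite fr'// er// mulr0 addr0.
    apply: le_trans (form_op_ge0 _ _ ur' te0) _.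
    have -> : \sum_(x <- r') form_op (fun x => f x + t * e x) x *
                (f x + t * e x) =
              \sum_(x <- r') form_op f x * f x +
              (t * \sum_(x <- r') form_op f x * e x +
               (t * \sum_(x <- r') form_op e x * f x +
                t ^+ 2 * \sum_(x <- r') form_op e x * e x)).
      rewrite !mulr_sumr -!big_split/=; apply: eq_bigr => x _.
      rewrite form_opD//.
      have -> : form_op (fun x => t * e x) x = t * form_op e x.
        by rewrite /form_op adjZ//; ring.
      by ring.
    rewrite (form_op_symmetric e f r' ur' er fr').
    under [X in _ + (_ + (t * X + _))]eq_bigr do rewrite mulrC.
    rewrite !sum_e ez; lra.
  set l := form_op f z in Q *; set D := rsum (b z) + c z in Q *.
  have D1 : 0 < `|D| + 1 by rewrite ltr_wpDl.
  have DD : D <= `|D| := ler_norm D.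
  (* [D] may have any sign, hence the denominator. This choice of [t] turns the quadratic into a
     square times [D - 2 (|D| + 1)], which is negative, so [l] must vanish. *)
  have := Q (- l / (`|D| + 1)).
  have -> : 2 * (- l / (`|D| + 1)) * l + (- l / (`|D| + 1)) ^+ 2 * D =
      (l / (`|D| + 1)) ^+ 2 * (D - 2 * (`|D| + 1)).
    by field; exact: lt0r_neq0.
  rewrite nmulr_lge0; last lra.
  move=> le0; have : (l / (`|D| + 1)) ^+ 2 == 0 by rewrite eq_le le0 sqr_ge0.
  rewrite sqrf_eq0 mulf_eq0 invr_eq0 (gt_eqF D1) orbF => /eqP//.
have prop z w : f z = 0 -> 0 < b z w -> f w = 0.
  move=> fz bzw; have := Lf z; rewrite /form_op fz mulr0 sub0r => /eqP.
  rewrite oppr_eq0 => /eqP adj0.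
  have := @rsum_lb _ _ (fun y => b z y * f y) [:: w].
  rewrite big_seq1 [rsum _]adj0 => /(_ _ _ isT) h.
  have {}h : b z w * f w <= 0.
    by apply: h => [y|]; [rewrite mulr_ge0|exact: (formal_domainP f).1].
  by apply/eqP; rewrite eq_le f0 -(pmulr_rle0 _ bzw) h.
(* Infinity of [X] provides a point outside the finite support, from which zeros spread. *)
have [z zr] : exists z, z \notin r.
  apply: contrapT => nz; apply: X_infinite.
  apply: (@sub_finite_set _ _ [set` r]); last exact: finite_seq.
  by move=> x _ /=; apply/negP => xr; apply: nz; exists x; exact/negP.
move=> x; have [q + <-] := b_connected z x.
elim: q z {zr} (fr _ zr) => //= w q ih z fz /andP[bzw]; apply: ih.
exact: prop bzw.
Qed.

(** The negative part [f] of [u] is supported in [r]. Where [u < 0], its diagonal term equals that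
    of [- u] while [adj f] dominates [adj (- u)], so [form_op f <= - form_op u <= 0]. The form is
    thus non-positive at [f], and definiteness gives [f = 0]. *)
Lemma minimum_principle u r : formal_domain b u ->
  (forall x, x \in r -> 0 <= form_op u x) ->
  (forall x, x \notin r -> 0 <= u x) -> forall x, 0 <= u x.
Proof.
move=> du Lu ur x; pose f y := Num.max (- u y) 0.
have f0 y : 0 <= f y by rewrite le_max lexx orbT.
have fr y : y \notin undup r -> f y = 0.
  by rewrite mem_undup => /ur uy; rewrite /f max_r// oppr_le0.
suff : f x = 0 by rewrite /f => fx; rewrite -oppr_le0 -fx le_max lexx.
apply: (form_op_definite f (undup r)) => //; first exact: undup_uniq.
rewrite big_seq; apply: sumr_le0 => y; rewrite mem_undup => yr.
have [uy|uy] := leP 0 (u y).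
  by rewrite {2}/f max_r ?oppr_le0// mulr0.
rewrite mulr_le0_ge0//; apply: (@le_trans _ _ (- form_op u y)); last first.
  by rewrite oppr_le0 Lu.
have : adj (fun z => - u z) y <= adj f y.
  apply: ler_adj; last exact: formal_domain_finite fr.
    by move=> z; rewrite /f le_max lexx.
  exact: formal_domainN.
rewrite adjN// /form_op {2}/f max_l; last by rewrite oppr_ge0 ltW.
move: (adj _ _) (adj _ _) => A1 A2; lra.
Qed.

(** Existence follows from uniqueness by finite dimension; uniqueness is the minimum principle for
    [v] and [- v]. *)
Lemma dirichlet_problem r f : uniq r ->
  exists2 v, forall x, x \notin r -> v x = 0 &
    forall x, x \in r -> form_op v x = f x.
Proof.
move=> ur; pose a x y := (rsum (b x) + c x) * (x == y)%:R - b x y.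
have aE v x : (forall x, x \notin r -> v x = 0) ->
    x \in r -> \sum_(y <- r) a x y * v y = form_op v x.
  move=> vr xr; rewrite /form_op (adj_finite _ _ _ ur vr).
  under eq_bigr do rewrite /a mulrBl; rewrite sumrB; congr (_ - _).
  rewrite (bigD1_seq x)//= eqxx mulr1 big1 ?addr0// => y.
  by rewrite eq_sym => /negbTE ->; rewrite mulr0 mul0r.
have [v vr|v vr vf] := @finite_system_solvable R X r a ur _ f; last first.
  by exists v => // x xr; rewrite -aE// vf.
move=> v0 x; have dv := formal_domain_finite _ _ vr.
have Lv y : y \in r -> form_op v y = 0 by move=> yr; rewrite -aE// v0.
apply/eqP; rewrite eq_le; apply/andP; split.
  rewrite -oppr_ge0.
  apply: (minimum_principle (fun x => - v x) r) => [|y yr|y /vr ->].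
  - exact: formal_domainN.
  - by rewrite form_opN// Lv// oppr0.
  - by rewrite oppr0.
by apply: (minimum_principle v r) => // [y /Lv ->|y /vr ->].
Qed.

(** * Dirichlet Green functions of the exhausting sets and their limit *)

Section GreenFunction.
Variable K : nat -> set X.
Hypothesis K_exhaustion : exhaustion K.

Let Ks n : seq X := finmap.enum_fset (fset_set (K n)).

Let Ks_uniq n : uniq (Ks n). Proof. exact: finmap.fset_uniq. Qed.

Let KsP n x : reflect (K n x) (x \in Ks n).
Proof.
have [Kfin _ _] := K_exhaustion.
have -> : (x \in Ks n) = (x \in K n) by exact: in_fset_set (Kfin n) x.
by apply: (iffP idP); rewrite inE.
Qed.

Let K_mono n k x : (n <= k)%N -> K n x -> K k x.
Proof.
have [_ Kinc _] := K_exhaustion.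
move=> /subnK <-; elim: (k - n)%N => // j ih /ih; exact: Kinc.
Qed.

Let K_cover x : exists n, K n x.
Proof.
have [_ _ KT] := K_exhaustion; have : [set: X] x by [].
by rewrite -KT => -[n _ Kx]; exists n.
Qed.

(** The pole [y] comes first, so that a partial application is a function on [X]. The value is
    meaningful only if [K n y]: otherwise the indicator of [y] is not in C(K n), whence the side
    condition throughout. *)
Definition green_approx n y x : R :=
  dirichlet_inverse b c m (K n) \1_[set y] x.

Lemma green_approxP n y : K n y ->
  (forall x, x \notin Ks n -> green_approx n y x = 0) /\
  (forall x, x \in Ks n -> form_op (green_approx n y) x = m y * (x == y)%:R).
Proof.
move=> Kny.
(* The pseudo-inverse is a right inverse on the image of H^K only, so the Dirichlet problem is
   solved first to place the indicator of [y] there. *)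
have surj : (dirichlet_restriction b c m (K n) @` supported_in (K n))
    (\1_[set y] : X -> R).
  have [v vr vf] := dirichlet_problem (Ks n) (fun x => m x * \1_[set y] x)
    (Ks_uniq n).
  exists v => [x /= /KsP/vr//|]; apply/funext => x.
  rewrite /dirichlet_restriction /patch; case: ifPn => [|xK].
    rewrite inE => /KsP /vf.
    rewrite -schrodingerE; last exact: formal_domain_finite vr.
    exact/mulfI/lt0r_neq0.
  rewrite indicE memNset// => xy; move: xK.
  by rewrite xy mem_set.
have inv : dirichlet_restriction b c m (K n) (green_approx n y) = \1_[set y].
  by apply: pinvK; rewrite inE.
have supp : supported_in (K n) (green_approx n y).
  apply: (surjpinv_image_sub (@subset_refl _
    (dirichlet_restriction b c m (K n) @` supported_in (K n)))).
  by exists (\1_[set y] : X -> R).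
have supp' x : x \notin Ks n -> green_approx n y x = 0.
  by move=> xr; apply: supp => /KsP; exact/negP.
split=> // x xr; rewrite -schrodingerE; last exact: formal_domain_finite supp'.
have := congr1 (@^~ x) inv; rewrite /dirichlet_restriction /patch.
rewrite mem_set; last exact/KsP.
move=> ->; rewrite indicE; case: eqVneq => [->|xy]; first by rewrite mem_set.
by rewrite memNset ?mulr0// => /eqP; exact/negP.
Qed.

Lemma green_approx_ge0 n y x : K n y -> 0 <= green_approx n y x.
Proof.
move=> /green_approxP[supp eqn].
apply: (minimum_principle _ (Ks n)) x => [|x /eqn ->|x /supp ->] //.
  exact: formal_domain_finite supp.
by rewrite mulr_ge0// ltW.
Qed.

(** The poles cancel in the difference, which is therefore harmonic on [K n] and non-negative
    outside; the minimum principle applies. *)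
Lemma green_approx_mono n k y x : (n <= k)%N -> K n y ->
  green_approx n y x <= green_approx k y x.
Proof.
move=> nk Kny; have Kky := K_mono _ _ _ nk Kny.
have [suppn eqn] := green_approxP _ _ Kny.
have [suppk eqk] := green_approxP _ _ Kky.
have dn := formal_domain_finite _ _ suppn.
have dk := formal_domain_finite _ _ suppk.
rewrite -subr_ge0.
apply: (minimum_principle (fun x => green_approx k y x - green_approx n y x)
  (Ks n)) => [|z zr|z zr].
- by apply: formal_domainD => //; exact: formal_domainN.
- rewrite form_opB// eqn// eqk ?subrr//.
  by move: zr => /KsP zr; apply/KsP; exact: K_mono zr.
- by rewrite suppn// subr0 green_approx_ge0.
Qed.

(** Pairing each Green function with the equation of the other evaluates the two sides of
    [form_op_symmetric] at the poles. *)
Lemma green_approx_sym n x y : K n x -> K n y ->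
  m x * green_approx n y x = m y * green_approx n x y.
Proof.
move=> Kx Ky; have [sx ex] := green_approxP _ _ Kx.
have [sy ey] := green_approxP _ _ Ky.
have sumE f z : K n z ->
    \sum_(w <- Ks n) f w * (m z * (w == z)%:R) = m z * f z.
  move=> /KsP zr; rewrite (bigD1_seq z)//= eqxx mulr1 mulrC big1 ?addr0// => w.
  by move=> /negbTE ->; rewrite !mulr0.
rewrite -!sumE// -[RHS](eq_bigr _ (fun w _ => mulrC _ _)).
have := form_op_symmetric _ _ _ (Ks_uniq n) sy sx.
rewrite big_seq [RHS in _ = RHS]big_seq => e.
rewrite big_seq [RHS]big_seq; apply/esym; move: e.
under eq_bigr => w wr do rewrite ey//.
by under [RHS in _ = RHS -> _]eq_bigr => w wr do rewrite ex//.
Qed.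

Definition green_bounded y x : Prop :=
  exists C, forall n, K n y -> green_approx n y x <= C.

(** By monotonicity, an early term is dominated by the term at [maxn N n], so a bound on the tail
    suffices. *)
Lemma green_boundedP y x N C :
  (forall n, (N <= n)%N -> K n y -> green_approx n y x <= C) ->
  green_bounded y x.
Proof.
move=> h; exists C => n Ky.
apply: (@le_trans _ _ (green_approx (maxn N n) y x)).
  by apply: green_approx_mono => //; exact: leq_maxr.
by apply: h; [exact: leq_maxl|apply: K_mono Ky; exact: leq_maxr].
Qed.

Lemma green_bounded_sym x y : green_bounded y x -> green_bounded x y.
Proof.
move=> [C GC]; have [N KNy] := K_cover y.
apply: (green_boundedP _ _ N (m x * C / m y)) => n Nn Kx.
have Ky := K_mono _ _ _ Nn KNy.
by rewrite ler_pdivlMr// mulrC -green_approx_sym// ler_wpM2l ?GC// ltW.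
Qed.

(* Harnack: [form_op u x >= 0] and [u >= 0] bound [b x z * u z] by a multiple
   of [u x]. *)
Lemma green_bounded_edge y x z : 0 < b x z ->
  green_bounded y x -> green_bounded y z.
Proof.
move=> bxz [C GC]; have [N KNx] := K_cover x.
pose d := rsum (b x) + c x.
apply: (green_boundedP _ _ N (`|d| * C / b x z)) => n Nn Ky.
rewrite ler_pdivlMr// mulrC.
have [supp eqn] := green_approxP _ _ Ky.
have /formal_domainP/(_ x) dn := formal_domain_finite _ _ supp.
apply: (@le_trans _ _ (d * green_approx n y x)); last first.
  apply: (@le_trans _ _ (`|d| * green_approx n y x)).
    by rewrite ler_wpM2r ?green_approx_ge0// ler_norm.
  by rewrite ler_wpM2l// GC.
apply: (@le_trans _ _ (adj (green_approx n y) x)).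
  have := rsum_lb _ [:: z] _ dn isT; rewrite big_seq1; apply=> w.
  by rewrite mulr_ge0 ?green_approx_ge0.
rewrite -subr_ge0.
have /eqn : x \in Ks n by apply/KsP; exact: K_mono KNx.
by rewrite /form_op => ->; rewrite mulr_ge0// ltW.
Qed.

Lemma green_bounded_path y x z : green_bounded y x -> green_bounded y z.
Proof.
have [q + <-] := b_connected x z.
elim: q x => //= w q ih x /andP[bxw] /ih {}ih /(green_bounded_edge _ _ _ bxw).
exact: ih.
Qed.

Lemma green_lty_bounded x y : (green b c m K x y < +oo)%E -> green_bounded y x.
Proof.
have [N KNy] := K_cover y.
pose u n := (green_approx n y x)%:E.
(* Monotonicity starts once [y] has entered [K N]; the shift by [N] discards the meaningless earlier
   terms. *)
have nd : nondecreasing_seq (fun n => u (n + N)%N).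
  move=> n k nk; rewrite lee_fin green_approx_mono ?leq_add2r//.
  by apply: K_mono KNy; exact: leq_addl.
have := ereal_nondecreasing_cvgn nd; rewrite (cvg_shiftn N u) => ucvg.
rewrite /green (cvg_lim _ ucvg)//; set l := ereal_sup _ => loo.
have ul n : (u (n + N)%N <= l)%E by apply: ereal_sup_ubound; exists n.
have lfin : l \is a fin_num.
  rewrite fin_real// loo andbT; apply: lt_le_trans (ul 0%N); exact: ltNyr.
apply: (green_boundedP _ _ N (fine l)) => n Nn Kny.
by rewrite -lee_fin fineK// -/(u n) -(subnK Nn).
Qed.

Lemma green_bounded_cvg x y : green_bounded y x ->
  [/\ green b c m K x y \is a fin_num,
      green_approx n y x @[n --> \oo] --> fine (green b c m K x y) &
      forall n, K n y -> green_approx n y x <= fine (green b c m K x y)].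
Proof.
move=> [C GC]; have [N KNy] := K_cover y.
have KN n : (N <= n)%N -> K n y by move=> Nn; exact: K_mono KNy.
have cv : cvgn (fun n => green_approx n y x).
  apply: (@near_nondecreasing_is_cvgn _ _ C).
    exists N => // k /= Nk n kn; apply: green_approx_mono => //; exact: KN.
  by exists N => // n /= /KN/GC.
have gE : green b c m K x y = (limn (fun n => green_approx n y x))%:E.
  by rewrite -EFin_lim.
rewrite gE/=; split=> // n Kny.
apply: limr_ge => //; exists n => // k /= nk.
exact: green_approx_mono.
Qed.

(** * Potentials as limits of finite approximations *)

Section Subcritical.
Hypothesis green_lty : exists x y, (green b c m K x y < +oo)%E.

(** Starting from the one pair with finite Green function, move the evaluation point to the new
    pole, exchange the two by symmetry, and move the evaluation point again. *)
Lemma subcritical_green_bounded x y : green_bounded y x.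
Proof.
have [x0 [y0 /green_lty_bounded Gxy]] := green_lty.
exact/(green_bounded_path _ y0)/green_bounded_sym/(green_bounded_path _ x0).
Qed.

Let G x y : R := fine (green b c m K x y).

Let greenE x y : green b c m K x y = (G x y)%:E.
Proof.
by have [Gfin _ _] := green_bounded_cvg _ _ (subcritical_green_bounded x y);
  rewrite fineK.
Qed.

Let green_cvg x y : green_approx n y x @[n --> \oo] --> (G x y : R).
Proof. by have [] := green_bounded_cvg _ _ (subcritical_green_bounded x y). Qed.

Let green_ub n x y : K n y -> green_approx n y x <= G x y.
Proof.
have [_ _] := green_bounded_cvg _ _ (subcritical_green_bounded x y); exact.
Qed.

Let G_ge0 x y : 0 <= G x y.
Proof.
have [n Kny] := K_cover y.
by apply: le_trans (green_ub n x y Kny); exact: green_approx_ge0.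
Qed.

Lemma green_domainP f :
  green_domain b c m K f <-> forall x, summable_real (fun y => G x y * f y).
Proof.
have e x : (fun y => green b c m K x y * `|f y|%:E)%E =
           (fun y => (`|G x y * f y|)%:E).
  by apply/funext => y; rewrite greenE normrM (ger0_norm (G_ge0 _ _)) EFinM.
by split=> /= df x; [apply/summable_realP; rewrite -e|rewrite e]; exact: df.
Qed.

Definition potential_approx f n x : R :=
  \sum_(y <- Ks n) green_approx n y x * f y.

Lemma potential_approxP f n :
  (forall x, x \notin Ks n -> potential_approx f n x = 0) /\
  (forall x, x \in Ks n -> form_op (potential_approx f n) x = m x * f x).
Proof.
split=> [x xr|x xr].
  rewrite /potential_approx big_seq big1// => y /KsP/green_approxP[supp _].
  by rewrite supp// mul0r.
(* Superposition of the equations for single poles. The induction carries membership in the formal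
   domain along, because [form_op] is additive only there. *)
have step r : {subset r <= Ks n} ->
    formal_domain b (fun x => \sum_(y <- r) green_approx n y x * f y) /\
    form_op (fun x => \sum_(y <- r) green_approx n y x * f y) x =
    \sum_(y <- r) m y * (x == y)%:R * f y.
  elim: r => [_|y r ih sub].
    under eq_fun do rewrite big_nil; rewrite big_nil.
    have d0 := @formal_domain_finite (fun=> 0) [::] (fun _ _ => erefl).
    split=> //; rewrite /form_op mulr0 (adj_finite _ [::])//.
    by rewrite big_nil subr0.
  have [|dr Lr] := ih; first by move=> z zr; apply: sub; rewrite inE zr orbT.
  have [supp eqn] := green_approxP n y (KsP _ _ (sub y (mem_head _ _))).
  have dy : formal_domain b (fun x => f y * green_approx n y x).
    by apply: (formal_domain_finite _ (Ks n)) => z /supp ->; rewrite mulr0.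
  under eq_fun do rewrite big_cons mulrC; rewrite big_cons.
  split; first exact: formal_domainD.
  rewrite form_opD// Lr; congr (_ + _); rewrite -eqn// mulrC.
  by rewrite /form_op adjZ; [ring|exact: formal_domain_finite supp].
have [_ ->] := step (Ks n) (fun _ => id).
rewrite (bigD1_seq x)//= eqxx mulr1 big1 ?addr0// => y.
by rewrite eq_sym => /negbTE ->; rewrite mulr0 mul0r.
Qed.

Let K_cover_seq r : exists N, {subset r <= Ks N}.
Proof.
elim: r => [|x r [N Nr]]; first by exists 0%N.
have [k Kkx] := K_cover x; exists (maxn N k) => y; rewrite inE.
move=> /predU1P[->|/Nr/KsP Ky]; apply/KsP.
  by apply: K_mono Kkx; exact: leq_maxr.
by apply: K_mono Ky; exact: leq_maxl.
Qed.

Let cvg_lin r (a : X -> R) (u : nat -> X -> R) (l : X -> R) :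
  (forall y, u n y @[n --> \oo] --> l y) ->
  \sum_(y <- r) a y * u n y @[n --> \oo] --> \sum_(y <- r) a y * l y.
Proof.
move=> ul; elim: r => [|y r ih].
  by under eq_fun do rewrite big_nil; rewrite big_nil; exact: cvg_cst.
under eq_fun do rewrite big_cons; rewrite big_cons.
by apply: cvgD => //; apply: cvgM => //; exact: cvg_cst.
Qed.

(** A finite [r] is eventually contained in [K n], where its sum with the approximate kernel is part
    of [potential_approx f n x]; then n tends to infinity with [r] fixed. *)
Lemma green_sum_ub f x C : (forall y, 0 <= f y) ->
  (forall n, potential_approx f n x <= C) ->
  forall r, uniq r -> \sum_(y <- r) G x y * f y <= C.
Proof.
move=> f0 pC r ur; under eq_bigr do rewrite mulrC.
have cv := cvg_lin r f (fun n y => green_approx n y x) (G x)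
  (fun y => green_cvg x y).
apply: (cvgr_to_le cv).
have [k rk] := K_cover_seq r.
exists k => // n /= kn; apply: le_trans (pC n); under eq_bigr do rewrite mulrC.
apply: ler_sum_subset => // [y /rk/KsP Ky|y /KsP Ky].
  by apply/KsP; exact: K_mono Ky.
by rewrite mulr_ge0// green_approx_ge0.
Qed.

Lemma potential_approx_mono f n k x : (forall y, 0 <= f y) -> (n <= k)%N ->
  potential_approx f n x <= potential_approx f k x.
Proof.
move=> f0 nk.
apply: (@le_trans _ _ (\sum_(y <- Ks n) green_approx k y x * f y)).
  rewrite /potential_approx big_seq [leRHS]big_seq; apply: ler_sum => y /KsP Ky.
  by rewrite ler_wpM2r// green_approx_mono.
apply: ler_sum_subset => // [y /KsP Ky|y /KsP Ky].
  by apply/KsP; exact: K_mono Ky.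
by rewrite mulr_ge0// green_approx_ge0.
Qed.

Lemma potential_approx_le f n x : (forall y, 0 <= f y) ->
  green_domain b c m K f -> potential_approx f n x <= green_op b c m K f x.
Proof.
move=> f0 /green_domainP sf.
apply: le_trans (rsum_lb _ (Ks n) _ (sf x) (Ks_uniq n)); last first.
  by move=> y; rewrite mulr_ge0.
rewrite /potential_approx big_seq [leRHS]big_seq; apply: ler_sum => y /KsP Ky.
by rewrite ler_wpM2r// green_ub.
Qed.

(** Monotone convergence: the approximations stay below the potential, while their limit bounds
    every partial sum of it by [green_sum_ub]. *)
Lemma potential_approx_cvg f x : (forall y, 0 <= f y) ->
  green_domain b c m K f ->
  potential_approx f n x @[n --> \oo] --> (green_op b c m K f x : R).
Proof.
move=> f0 df; set u := fun n => potential_approx f n x.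
have nd : nondecreasing_seq u by move=> n k; exact: potential_approx_mono.
have cu : cvgn u.
  apply: nondecreasing_is_cvgn => //.
  exists (green_op b c m K f x) => _ [n _ <-].
  exact: potential_approx_le.
suff <- : limn u = green_op b c m K f x by [].
apply/eqP; rewrite eq_le; apply/andP; split.
  by apply: limr_le => //; apply: nearW => n; exact: potential_approx_le.
apply: (rsum_ub _ _ _ _).2 => [y|]; first exact: mulr_ge0 (G_ge0 x y) (f0 y).
by apply: (green_sum_ub f x (limn u)) => // n; exact: nondecreasing_cvgn_le.
Qed.

Lemma green_op_ge0 f x : (forall y, 0 <= f y) -> green_domain b c m K f ->
  0 <= green_op b c m K f x.
Proof.
move=> f0 /green_domainP sf; apply: rsum_ge0 => [y|]; last exact: sf.
exact: mulr_ge0 (G_ge0 x y) (f0 y).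
Qed.

(* Every partial sum of [adj p] is a limit of partial sums of [adj p_n], where
   the [p_n] increase to [p] and satisfy [adj p_n = d p_n - m f] eventually. *)
Lemma schrodinger_green_op f : (forall y, 0 <= f y) -> green_domain b c m K f ->
  formal_domain b (green_op b c m K f) ->
  forall x, schrodinger b c m (green_op b c m K f) x = f x.
Proof.
move=> f0 df dp x; set p := green_op b c m K f in dp *.
have p0 y : 0 <= p y by exact: green_op_ge0.
apply: (mulfI (lt0r_neq0 (m_gt0 x))); rewrite schrodingerE//.
pose d := rsum (b x) + c x; pose u := potential_approx f.
have up y : u n y @[n --> \oo] --> p y by exact: potential_approx_cvg.
have u0 n y : 0 <= u n y.
  rewrite /u/potential_approx big_seq sumr_ge0// => z /KsP Kz.
  by rewrite mulr_ge0// green_approx_ge0.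
have dup : d * u n x - m x * f x @[n --> \oo] --> d * p x - m x * f x.
  by apply: cvgB; [apply: cvgM => //; exact: cvg_cst|exact: cvg_cst].
have du n : formal_domain b (u n).
  by have [supp _] := potential_approxP f n; exact: formal_domain_finite supp.
have [N KN] := K_cover x.
have adju n : (N <= n)%N -> adj (u n) x = d * u n x - m x * f x.
  move=> Nn; have [_ eqn] := potential_approxP f n.
  rewrite -eqn; last by apply/KsP; exact: K_mono KN.
  by rewrite /form_op opprB addrC subrK.
suff : adj p x = d * p x - m x * f x.
  by rewrite /form_op => ->; rewrite opprB addrC subrK.
apply/eqP; rewrite eq_le; apply/andP; split.
  apply: (rsum_ub _ _ _ _).2 => [y|r ur]; first by rewrite mulr_ge0.
  apply: (ler_cvg_to (cvg_lin r (b x) u p up) dup).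
  exists N => // n /= Nn; rewrite -adju//.
  apply: rsum_lb => // [y|]; first by rewrite mulr_ge0.
  exact: (formal_domainP _).1.
(* For the reverse inequality, [u n <= p] gives [adj (u n) <= adj p] before the limit is taken. *)
apply: (cvgr_to_le dup); exists N => // n /= Nn; rewrite -adju//.
by apply: ler_adj => // y; exact: potential_approx_le.
Qed.

(** * The Riesz decomposition *)

(** The function [s - g - p_n], with [p_n] the approximate potential of [H s], has [form_op] equal
    to [- m H g >= 0] on [K n] and equals [s - g >= 0] elsewhere. Hence [p_n <= s - g] for all n,
    which yields both summability and the bound in the limit. *)
Lemma green_op_le_minorant s g : superharmonic b c m s ->
  subharmonic b c m g -> minorant g s ->
  green_domain b c m K (schrodinger b c m s) /\
  forall x, green_op b c m K (schrodinger b c m s) x <= s x - g x.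
Proof.
move=> [ds Hs] [dg Hg] gs; set f := schrodinger b c m s.
have approx n x : potential_approx f n x <= s x - g x.
  have [supp eqn] := potential_approxP f n.
  have dn := formal_domain_finite _ _ supp.
  have dsg : formal_domain b (fun x => s x - g x).
    by apply: formal_domainD => //; exact: formal_domainN.
  rewrite -subr_ge0.
  apply: (minimum_principle
    (fun x => s x - g x - potential_approx f n x) (Ks n)).
  - by apply: formal_domainD => //; exact: formal_domainN.
  - move=> y yr; rewrite form_opB// form_opB// eqn// -!schrodingerE//.
    rewrite /f addrAC subrr sub0r -mulrN mulr_ge0//; first exact: ltW.
    by rewrite oppr_ge0.
  - by move=> y /supp ->; rewrite subr0 subr_ge0.
have ub x : summable_real (fun y => G x y * f y) /\
    rsum (fun y => G x y * f y) <= s x - g x.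
  apply: rsum_ub => [y|]; first by rewrite mulr_ge0// Hs.
  by apply: (green_sum_ub f x) => // y; exact: Hs.
by split=> [|x]; [apply/green_domainP => x|]; case: (ub x).
Qed.

Lemma superharmonic_riesz s : superharmonic b c m s ->
  (exists2 g, subharmonic b c m g & minorant g s) ->
  riesz_decomposition b c m K s (green_op b c m K (schrodinger b c m s))
    (fun x => s x - green_op b c m K (schrodinger b c m s) x).
Proof.
move=> sH [g gH gs]; have [ds Hs] := sH; have [dg _] := gH.
set p := green_op b c m K _.
have [df psg] := green_op_le_minorant _ _ sH gH gs.
have p0 x : 0 <= p x by exact: green_op_ge0.
(* Membership follows from [0 <= p <= s - g]; only then does [H p = H s] become available. *)
have dp : formal_domain b p.
  apply: (@formal_domain_le _ (fun x => s x - g x)).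
    by move=> x; rewrite !ger0_norm ?subr_ge0.
  by apply: formal_domainD => //; exact: formal_domainN.
split=> //; first by move=> x; rewrite addrC subrK.
split.
- split; first by apply: formal_domainD => //; exact: formal_domainN.
  move=> x; apply: (mulfI (lt0r_neq0 (m_gt0 x))).
  rewrite schrodingerE; last first.
    by apply: formal_domainD => //; exact: formal_domainN.
  by rewrite form_opB// -!schrodingerE// schrodinger_green_op// subrr mulr0.
- by move=> x; rewrite gerBl.
(* A harmonic minorant [h] is itself an admissible subharmonic one, so [p <= s - h], that is,
   [h <= s - p]. *)
- move=> h [dh Hh] hs x; have hH : subharmonic b c m h.
    by split=> // y; rewrite Hh.
  by have [_ /(_ x)] := green_op_le_minorant _ _ sH hH hs; rewrite -/p; lra.
Qed.

End Subcritical.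
End GreenFunction.
End Nonnegative.
End SchrodingerForm.

Theorem theorem2p4 (R : realType) (X : choiceType)
  (b : X -> X -> R) (c m : X -> R) (K : nat -> set X) (s : X -> R)
  (X_infinite : infinite_set [set: X])
  (b_graph : is_graph b) (b_connected : connected_graph b)
  (m_gt0 : forall x, 0 < m x)
  (K_exhaustion : exhaustion K)
  (H_subcritical : subcritical b c m K)
  (s_superharmonic : superharmonic b c m s)
  (s_subharmonic_minorant : exists2 g, subharmonic b c m g & minorant g s) :
  (exists! d : (X -> R) * (X -> R), riesz_decomposition b c m K s d.1 d.2) /\
  (exists h, is_ghm b c m s h) /\
  (forall sp sh, riesz_decomposition b c m K s sp sh ->
     ((forall x, 0 <= s x) -> forall x, 0 <= sh x) /\
     ((exists2 f, (forall x, 0 <= f x) & potential_of b c m K s f) <->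
      (forall x, sh x = 0))).
Proof.
have [form_ge0 green_lty] := H_subcritical.
have dec := superharmonic_riesz b c m X_infinite b_graph b_connected m_gt0
  form_ge0 K K_exhaustion green_lty s s_superharmonic s_subharmonic_minorant.
set p := green_op _ _ _ _ _ in dec.
have [_ Hs] := s_superharmonic; have [ds _] := s_superharmonic.
split; [|split].
(* Uniqueness: the charge is prescribed as [H s], which fixes the potential part and, by
   subtraction, the harmonic part. *)
- exists (p, fun x => s x - p x); split=> // -[sp sh] /= [ssh _ [_ spE] _].
  rewrite spE; congr pair; apply/funext => x.
  by rewrite ssh spE addrAC subrr add0r.
- by case: dec => _ _ _ ghm; exists (fun x => s x - p x).
move=> sp sh [ssh _ [df spE] [_ _ ghm]]; split.
  (* The zero function is harmonic; if [s >= 0] it is a minorant of [s], hence lies below [sh]. *)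
  have zero : formal_domain b (fun=> 0).
    exact: (formal_domain_finite b b_graph _ [::] (fun _ _ => erefl)).
  move=> s0 x; apply: (ghm (fun=> 0)) => //; split=> // y.
  apply: (mulfI (lt0r_neq0 (m_gt0 y))); rewrite mulr0 schrodingerE//.
  by rewrite /form_op mulr0 (adj_finite _ _ [::])// big_nil subr0.
split=> [[f f0 [dgf sE]] x|sh0].
  (* Applying [H] to [s = G f] recovers the charge, so [s] coincides with [sp] and nothing remains
     for [sh]. *)
  have fE : schrodinger b c m s = f.
    apply/funext => y; rewrite sE; apply: schrodinger_green_op => //.
    by rewrite -sE.
  have := ssh x; rewrite spE fE -sE; lra.
(* Conversely, [sh = 0] leaves [s = sp], whose charge [H s] is non-negative by superharmonicity. *)
exists (schrodinger b c m s) => //; split=> //.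
by rewrite -spE; apply/funext => x; rewrite ssh sh0 addr0.
Qed.
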